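(* Suppose $X$ has a minimum $a$ but no maximum. Let $\varphi\in\mathcal{OP}(X)\setminus\mathcal{O}(X)$ with ideal $X_1$, and let $X_2=X\setminus X_1$. Then $\langle \mathcal{O}(X),\varphi\rangle=\mathcal{OP}(X)$ if and only if, for each $i\in\{1,2\}$, there is a set $Y_i\subseteq X_i$ which is order-isomorphic to an open convex subset of $X$ such that $\varphi|_{Y_i}$ is an order-isomorphism (from $Y_i$ onto $Y_i\varphi$), and $\{x\in X : y\varphi<x \text{ for all } y\in Y_1\}=\emptyset$.
   Context: Maps are written on the right of their arguments and composed from left to right. Throughout, $X$ is an infinite linearly ordered set that is dense (for all $x<y$ in $X$ there is $z\in X$ with $x<z<y$). A subset $C\subseteq X$ is convex if $x,y\in C$, $z\in X$ and $x<z<y$ imply $z\in C$; an open convex subset of $X$ is a nonempty convex subset of $X$ having neither a minimum nor a maximum. For sets, $A<B$ means $a<b$ for all $a\in A$, $b\in B$. It is assumed that $X$ satisfies: (a) if $X=X'\cup X''$ with $X'<X''$ and $X',X''\neq\emptyset$, then $X'$ has a maximum or $X''$ has a minimum; (b) any two open convex subsets of $X$ are order-isomorphic. $\mathcal{T}(X)$ is the monoid of all maps $X\to X$ under composition, and $\mathcal{O}(X)$ is its submonoid of order-preserving maps ($x\le y$ implies $x\alpha\le y\alpha$). An order-isomorphism is an order-preserving bijection between subchains; subchains are order-isomorphic if there is an order-isomorphism between them. A map $\alpha\in\mathcal{T}(X)$ is orientation-preserving if there is a nonempty subset $X_1\subseteq X$ such that, with $X_2=X\setminus X_1$: (1) $\alpha$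 is order-preserving on $X_1$ and on $X_2$; and (2) for all $p\in X_1$ and $q\in X_2$, $p<q$ and $p\alpha\ge q\alpha$. Such a set $X_1$ is called an ideal of $\alpha$; it is unique if $\alpha$ is non-constant. $\mathcal{OP}(X)$ is the monoid of all orientation-preserving maps on $X$, and $\mathcal{O}(X)\subseteq\mathcal{OP}(X)$. $\langle\mathcal{O}(X),\varphi\rangle$ denotes the subsemigroup generated by $\mathcal{O}(X)\cup\{\varphi\}$. *)

(* Defs.v *)
From HB Require Import structures.
From mathcomp Require Import all_boot all_order.
From mathcomp Require Import boolp classical_sets functions cardinality.

Set Implicit Arguments.
Unset Strict Implicit.
Unset Printing Implicit Defensive.

Local Open Scope order_scope.
Local Open Scope classical_set_scope.

Section Chains.
Context {d : Order.disp_t} {X : orderType d}.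
Implicit Types (A B C : set X) (f : X -> X).

Definition is_min A m := A m /\ lbound A m.
Definition is_max A m := A m /\ ubound A m.
Definition has_min A := exists m, is_min A m.
Definition has_max A := exists m, is_max A m.

Definition set_lt A B := forall a b, A a -> B b -> a < b.

Definition convex_set C := forall x y z, C x -> C y -> x < z -> z < y -> C z.

Definition open_convex C :=
  [/\ C !=set0, convex_set C, ~ has_min C & ~ has_max C].

Definition order_preserving_on A f := {in A &, {homo f : x y / x <= y}}.

(* Only the values of f on A matter; f is a total extension of a map A -> B. *)
Definition order_iso A B f := order_preserving_on A f /\ set_bij A B f.

Definition order_isomorphic A B := exists f, order_iso A B f.

(* The submonoid O(X) of the monoid of all maps X -> X. *)
Definition OX : set (X -> X) := [set f | {homo f : x y / x <= y}].

(* X1 is an ideal of f, with X2 := ~` X1 its (possibly empty) complement. *)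
Definition is_ideal f (X1 : set X) :=
  [/\ X1 !=set0,
      order_preserving_on X1 f,
      order_preserving_on (~` X1) f &
      forall p q, X1 p -> (~` X1) q -> p < q /\ f q <= f p].

Definition OPX : set (X -> X) := [set f | exists X1, is_ideal f X1].

(* Maps act on the right in the source, so its product f g is g \o f here. *)
Definition subsemigroup (S : set (X -> X)) :=
  forall f g, S f -> S g -> S (g \o f).

Definition generated_subsemigroup (G : set (X -> X)) : set (X -> X) :=
  smallest subsemigroup G.

End Chains.

Section ChainAxioms.
Context {d : Order.disp_t} (X : orderType d).

Definition dense_chain := forall x y : X, x < y -> exists z, x < z /\ z < y.

Definition cut_condition :=
  forall X' X'' : set X, X' `|` X'' = [set: X] -> set_lt X' X'' ->
    X' !=set0 -> X'' !=set0 -> has_max X' \/ has_min X''.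

Definition open_convex_isomorphic :=
  forall C D : set X, open_convex C -> open_convex D -> order_isomorphic C D.

End ChainAxioms.

(* Main.v *)
Require Import Defs.
From HB Require Import structures.
From mathcomp Require Import all_boot all_order.
From mathcomp Require Import boolp classical_sets functions cardinality.

Set Implicit Arguments.
Unset Strict Implicit.
Unset Printing Implicit Defensive.

Local Open Scope order_scope.
Local Open Scope classical_set_scope.

Import Order.TTheory.

(** Sufficiency.  Let [alpha] be orientation-preserving with ideal [A] and
    nonempty complement [A2].  Embed [A] into [Y1] and [A2] into [Y2] by one
    order-preserving map [theta]; then [theta] followed by [phi] is increasing
    on [A] and on [A2] and puts the image of [A2] strictly below that of [A], so
    [alpha] factors through it by a monotone partial map.  As [X] is complete
    and has a minimum, this partial map extends to [X] by suprema, provided that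
    its values at the arguments below any given point of [X] are bounded
    ([OX_factor]).  The only obstacle is an [alpha] unbounded on [A]: then [A]
    has no maximum, [theta] can be chosen to embed [A] cofinally in [Y1]
    ([cofinal_embedding]), and since [phi] is unbounded on [Y1], no point lies
    above the whole image of [A].  Thus [alpha] is a product of [theta], [phi]
    and one more order-preserving map ([OPX_factor]).

    Necessity.  Each of [Y1] and [Y2] is obtained by exhibiting a property of
    maps that holds for order-preserving maps, is stable under composition,
    fails for some orientation-preserving map, and can fail for [phi] only if
    the wanted set exists.  For [Y2] the property says that an injective
    composite with an order-preserving map is order-preserving
    ([generated_embeds_compl]); for [Y1] it says that a bounded set of open
    convex type on which the map is injective is not stretched to an unbounded
    one ([generated_embeds_ideal]). *)

(** * Order embeddings and order-isomorphisms *)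

Section Embeddings.
Context {d : Order.disp_t} {X : orderType d}.
Implicit Types (A B C D Y : set X) (f g h : X -> X).

(** [f] restricts to an order embedding of the subchain [A]. *)
Definition strict_on A f := forall x y, A x -> A y -> x < y -> f x < f y.

Lemma order_preserving_onP A f :
  order_preserving_on A f <-> (forall x y, A x -> A y -> x <= y -> f x <= f y).
Proof.
split=> [H x y Ax Ay|H x y]; first by apply: H; rewrite inE.
by rewrite !inE; apply: H.
Qed.

Lemma strict_on_le A f x y :
  strict_on A f -> A x -> A y -> x <= y -> f x <= f y.
Proof.
by move=> sf Ax Ay; rewrite le_eqVlt => /predU1P[->//|/(sf _ _ Ax Ay)/ltW].
Qed.

Lemma strict_on_inj A f x y : strict_on A f -> A x -> A y -> f x = f y -> x = y.
Proof.
move=> sf Ax Ay e; case: (ltgtP x y) => //.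
  by move=> /(sf _ _ Ax Ay); rewrite e ltxx.
by move=> /(sf _ _ Ay Ax); rewrite e ltxx.
Qed.

Lemma strict_on_lt_inv A f x y :
  strict_on A f -> A x -> A y -> f x < f y -> x < y.
Proof.
by move=> sf Ax Ay; case: (ltP x y) => // /(strict_on_le sf Ay Ax); case: ltP.
Qed.

Lemma strict_on_sub A B f : A `<=` B -> strict_on B f -> strict_on A f.
Proof. by move=> AB sf x y /AB Bx /AB; apply: sf. Qed.

Lemma strict_on_comp A B f g :
  strict_on A f -> (forall x, A x -> B (f x)) -> strict_on B g ->
  strict_on A (g \o f).
Proof.
by move=> sf fAB sg x y Ax Ay xy; apply: sg; [exact: fAB..|exact: sf].
Qed.

Lemma strict_on_homo_inj A f :
  (forall x y, A x -> A y -> x <= y -> f x <= f y) ->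
  (forall x y, A x -> A y -> f x = f y -> x = y) -> strict_on A f.
Proof.
move=> mf injf x y Ax Ay xy; rewrite lt_neqAle mf ?(ltW xy)// andbT.
by apply/eqP => /(injf _ _ Ax Ay) exy; rewrite exy ltxx in xy.
Qed.

Lemma order_isoE A B f : order_iso A B f <-> strict_on A f /\ f @` A = B.
Proof.
split=> [[/order_preserving_onP mf [fAB injf sfB]]|[sf <-]].
  split; first apply: strict_on_homo_inj => // x y Ax Ay.
    by apply: injf; rewrite inE.
  by rewrite eqEsubset; split=> // y [x Ax <-]; apply: fAB.
split; first by apply/order_preserving_onP => x y; apply: strict_on_le.
by split=> // x y; rewrite !inE; apply: strict_on_inj.
Qed.

Lemma order_isomorphicP A B :
  order_isomorphic A B <-> exists2 f, strict_on A f & f @` A = B.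
Proof.
by split=> [[f /order_isoE[]]|[f sf fAB]]; exists f => //; apply/order_isoE.
Qed.

Lemma order_isomorphic_trans A B C :
  order_isomorphic A B -> order_isomorphic B C -> order_isomorphic A C.
Proof.
move=> /order_isomorphicP[f sf <-] /order_isomorphicP[g sg <-].
apply/order_isomorphicP; exists (g \o f); last by rewrite image_comp.
by apply: strict_on_comp sg => // x Ax; exists x.
Qed.

Lemma order_isomorphic_sym A B : order_isomorphic A B -> order_isomorphic B A.
Proof.
move=> /order_isomorphicP[f sf <-]; apply/order_isomorphicP.
have /choice[g gP] y : exists x, (f @` A) y -> A x /\ f x = y.
  by case: (pselect ((f @` A) y)) => [[x Ax e]|ny]; [exists x|exists y].
have gA x : A x -> g (f x) = x.
  move=> Ax; have [|Ag] := gP (f x); first by exists x.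
  exact: strict_on_inj sf Ag Ax.
exists g.
  move=> _ _ [x Ax <-] [y Ay <-]; rewrite !gA//.
  exact: strict_on_lt_inv sf Ax Ay.
rewrite image_comp eqEsubset; split=> [_ [x Ax <-]/=|x Ax]; first by rewrite gA.
by exists x => //=; rewrite gA.
Qed.

(** [Y] is order-isomorphic to some open convex subset of the chain. *)
Definition iso_open Y := exists C, open_convex C /\ order_isomorphic Y C.

Lemma iso_open_image Y f :
  iso_open Y -> strict_on Y f -> iso_open (f @` Y).
Proof.
move=> [D [oD YD]] sf; exists D; split=> //; apply: order_isomorphic_trans YD.
by apply: order_isomorphic_sym; apply/order_isomorphicP; exists f.
Qed.

Lemma open_convex_iso_open C : open_convex C -> iso_open C.
Proof.
move=> oC; exists C; split=> //; apply/order_isomorphicP; exists id => //.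
by rewrite image_id.
Qed.

Lemma iso_open_neq0 C : iso_open C -> C !=set0.
Proof.
move=> [D [[[y Dy] _ _ _] /order_isomorphicP[f _ fCD]]].
by move: Dy; rewrite -fCD => -[x Cx _]; exists x.
Qed.

Lemma iso_open_gt C x :
  iso_open C -> C x -> exists2 y, C y & x < y.
Proof.
move=> [D [[_ _ _ nmaxD] /order_isomorphicP[f sf fCD]]] Cx.
apply: contrapT => nex; apply: nmaxD; exists (f x); rewrite -fCD; split.
  by exists x.
move=> _ [y Cy <-]; apply: (strict_on_le sf) => //.
by rewrite leNgt; apply/negP => xy; apply: nex; exists y.
Qed.

Lemma open_convex_above (Xd : dense_chain X) C x :
  open_convex C -> C x -> open_convex (C `&` [set y | x < y]).
Proof.
move=> oC Cx; have [_ cC _ _] := oC.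
have up y : C y -> exists2 z, C z & y < z.
  by apply: iso_open_gt; apply: open_convex_iso_open.
split.
- by have [y Cy xy] := up _ Cx; exists y.
- move=> u v w [Cu /= xu] [Cv _] uw wv; split=> /=; first exact: cC uw wv.
  exact: lt_trans xu uw.
- move=> [m [[Cm /= xm] lbm]]; have [z [xz zm]] := Xd _ _ xm.
  have : m <= z by apply: lbm; split=> //; apply: cC xz zm.
  by rewrite leNgt zm.
- move=> [m [[Cm /= xm] ubm]]; have [z Cz mz] := up _ Cm.
  have : z <= m by apply: ubm; split=> //=; apply: lt_trans mz.
  by rewrite leNgt mz.
Qed.

Lemma iso_open_above (Xd : dense_chain X) Y y :
  iso_open Y -> Y y -> iso_open (Y `&` [set z | y < z]).
Proof.
move=> [C [oC /order_isomorphicP[f sf fYC]]] Yy.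
exists (C `&` [set z | f y < z]); split.
  by apply: open_convex_above => //; rewrite -fYC; exists y.
apply/order_isomorphicP; exists f; first by apply: strict_on_sub sf => ? [].
rewrite eqEsubset -fYC; split=> [_ [z [Yz /= yz] <-]|_ [[z Yz <-] /= fyz]].
  by split; [exists z|apply: sf].
by exists z => //; split=> //; apply: strict_on_lt_inv sf _ _ _.
Qed.

End Embeddings.

(** * Orientation-preserving maps *)

Section OrientationPreserving.
Context {d : Order.disp_t} {X : orderType d}.
Implicit Types (A B : set X) (f g h : X -> X).

Lemma OX_OPX (x : X) f : OX f -> OPX f.
Proof.
move=> fO; exists setT; split=> //; first by exists x.
- by apply/order_preserving_onP => *; apply: fO.
- by apply/order_preserving_onP => *; apply: fO.
Qed.

Lemma OX_comp f g : OX f -> OX g -> OX (g \o f).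
Proof. by move=> fO gO x y xy; apply/gO/fO. Qed.

Lemma is_idealP f A : is_ideal f A <->
  [/\ A !=set0, (forall x y, A x -> A y -> x <= y -> f x <= f y),
      (forall x y, ~ A x -> ~ A y -> x <= y -> f x <= f y),
      (forall x y, A x -> ~ A y -> x < y) &
      (forall x y, A x -> ~ A y -> f y <= f x)].
Proof.
split.
  move=> [A0 /order_preserving_onP f1 /order_preserving_onP f2 f12].
  by split=> // x y Ax Ay; case: (f12 x y).
move=> [A0 f1 f2 lt12 f12]; split=> //; try exact/order_preserving_onP.
by move=> p q Ap Aq; split; [apply: lt12|apply: f12].
Qed.

Lemma ideal_OX f A : is_ideal f A -> (forall x, A x) -> OX f.
Proof. by move=> /is_idealP[_ f1 _ _ _] AT x y; apply: f1. Qed.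

Lemma ideal_compl_up f A x y : is_ideal f A -> ~ A x -> x <= y -> ~ A y.
Proof.
move=> /is_idealP[_ _ _ lt12 _] nAx xy Ay.
by have := lt12 _ _ Ay nAx; rewrite ltNge xy.
Qed.

Lemma ideal_lower f A x y : is_ideal f A -> A y -> x <= y -> A x.
Proof.
by move=> iA Ay xy; apply: contrapT => nAx; apply: (ideal_compl_up iA nAx xy).
Qed.

(** Let [A] and [B] be the ideals of [f] and [g].  If [f] sends the complement
    of [A] into [B], the ideal of the composite is the part of [A] sent into
    [B], or the whole chain when that part is empty.  Otherwise it consists of
    [A] and of the part of the complement of [A] sent into [B]. *)
Lemma OPX_comp f g : OPX f -> OPX g -> OPX (g \o f).
Proof.
move=> [A iA] [B iB].
have /is_idealP[[x0 Ax0] f1 f2 lt12 f12] := iA.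
have /is_idealP[_ g1 g2 ltB g12] := iB.
have Bdown := ideal_lower iB.
case: (pselect (forall y, ~ A y -> B (f y))) => [fA2|nfA2].
  case: (pselect (exists x, A x /\ B (f x))) => [[x1 [Ax1 Bx1]]|nAB].
    exists (fun x => A x /\ B (f x)); apply/is_idealP; split=> /=.
    - by exists x1.
    - by move=> x y [Ax Bx] [Ay By] xy; apply: g1 => //; apply: f1.
    - move=> x y nx ny xy; case: (pselect (A x)) => Ax.
        have nBx : ~ B (f x) by move=> Bx; apply: nx.
        case: (pselect (A y)) => Ay; last by apply: g12 => //; apply: fA2.
        by apply: g2 => //; [move=> By; apply: ny|apply: f1].
      have nAy := ideal_compl_up iA Ax xy.
      by apply: g1; [exact: fA2..|exact: f2].
    - move=> x y [Ax Bx] ny; case: (pselect (A y)) => Ay; last exact: lt12.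
      rewrite ltNge; apply/negP => yx; apply: ny; split=> //.
      by apply: Bdown Bx _; apply: f1.
    - move=> x y [Ax Bx] ny; case: (pselect (A y)) => Ay.
        by apply: g12 => // By; apply: ny.
      by apply: g1 => //; [exact: fA2|exact: f12].
  apply: (OX_OPX x0) => x y xy /=; case: (pselect (A x)) => Ax.
    have nBx : ~ B (f x) by move=> Bx; apply: nAB; exists x.
    case: (pselect (A y)) => Ay; last by apply: g12 => //; apply: fA2.
    by apply: g2 => //; [move=> By; apply: nAB; exists y|apply: f1].
  have nAy := ideal_compl_up iA Ax xy.
  by apply: g1; [exact: fA2..|exact: f2].
have [y0 [nAy0 nBy0]] : exists y, ~ A y /\ ~ B (f y).
  apply: contrapT => H; apply: nfA2 => y nAy; apply: contrapT => nB.
  by apply: H; exists y.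
have fA1 x : A x -> ~ B (f x).
  by move=> Ax; apply: (ideal_compl_up iB nBy0); apply: f12.
exists (fun x => A x \/ B (f x)); apply/is_idealP; split=> /=.
- by exists x0; left.
- move=> x y hx hy xy; case: (pselect (A y)) => Ay.
    have Ax := ideal_lower iA Ay xy.
    by apply: g2; [exact: fA1..|exact: f1].
  have By : B (f y) by case: hy.
  case: (pselect (A x)) => Ax; first by apply: g12 => //; apply: fA1.
  by case: hx => // Bx; apply: g1 => //; apply: f2.
- by move=> x y /not_orP[Ax Bx] /not_orP[Ay By] xy; apply: g2 => //; apply: f2.
- move=> x y hx /not_orP[Ay By]; case: (pselect (A x)) => Ax; first exact: lt12.
  have Bx : B (f x) by case: hx.
  by rewrite ltNge; apply/negP => yx; apply: By; apply: Bdown Bx _; apply: f2.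
- move=> x y hx /not_orP[Ay By]; case: (pselect (A x)) => Ax.
    by apply: g2 => //; [exact: fA1|exact: f12].
  by have Bx : B (f x) by [case: hx]; apply: g12.
Qed.

End OrientationPreserving.

(** * Complete dense chains with a minimum and no maximum *)

Section MinimumNoMaximum.
Context {d : Order.disp_t} {X : orderType d}.
Context (X_dense : dense_chain X) (X_cut : cut_condition X).
Context (X_open_convex : open_convex_isomorphic X).
Context {a : X} (a_min : is_min [set: X] a).
Context (X_no_max : ~ has_max [set: X]).
Implicit Types (A B C D Y : set X) (f g h : X -> X).

Lemma le_a x : a <= x. Proof. by case: a_min => _; apply. Qed.

Lemma exists_gt x : exists y : X, x < y.
Proof.
apply: contrapT => H; apply: X_no_max; exists x; split=> // y _.
by rewrite leNgt; apply/negP => xy; apply: H; exists y.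
Qed.

Lemma open_convex_ray b : open_convex [set x : X | b < x].
Proof.
split.
- by have [y] := exists_gt b; exists y.
- by move=> x y z /= bx _ xz _; apply: lt_trans xz.
- move=> [m [/= bm lbm]]; have [z [bz zm]] := X_dense bm.
  by have := lbm z bz; rewrite leNgt zm.
- move=> [m [/= bm ubm]]; have [z mz] := exists_gt m.
  by have := ubm z (lt_trans bm mz); rewrite leNgt mz.
Qed.

Lemma open_convex_itv b c : b < c -> open_convex [set x : X | b < x < c].
Proof.
move=> bc; split.
- by have [z [bz zc]] := X_dense bc; exists z => /=; rewrite bz.
- move=> x y z /= /andP[bx _] /andP[_ yc] xz zy.
  by rewrite (lt_trans bx xz) (lt_trans zy yc).
- move=> [m [/= /andP[bm mc] lbm]]; have [z [bz zm]] := X_dense bm.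
  by have := lbm z; rewrite /= bz (lt_trans zm mc) leNgt zm => /(_ isT).
- move=> [m [/= /andP[bm mc] ubm]]; have [z [mz zc]] := X_dense mc.
  by have := ubm z; rewrite /= zc (lt_trans bm mz) leNgt mz => /(_ isT).
Qed.

(** The minimum of [X] is the least upper bound of the empty set. *)
Lemma exists_lub (S : set X) u :
  ubound S u -> exists s, ubound S s /\ forall v, ubound S v -> s <= v.
Proof.
move=> Su; case: (pselect ((~` ubound S) !=set0)) => [nub0|nub0]; last first.
  exists a; split=> [|v _]; last exact: le_a.
  by apply: contrapT => na; apply: nub0; exists a.
have cutP v w : ~ ubound S v -> ubound S w -> exists2 s, S s & v < s.
  move=> nv _; apply: contrapT => H; apply: nv => s Ss.
  by rewrite leNgt; apply/negP => vs; apply: H; exists s.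
have [|v w nv uw|//||[m [nm mub]]|[m [um lbm]]] :=
    X_cut (X' := ~` ubound S) (X'' := ubound S).
- by rewrite setUC setUv.
- by have [s Ss vs] := cutP v w nv uw; apply: lt_le_trans vs (uw _ Ss).
- by exists u.
- have [s Ss ms] := cutP m u nm Su; have [z [mz zs]] := X_dense ms.
  have : z <= m by apply: mub => uz; have := uz _ Ss; rewrite leNgt zs.
  by rewrite leNgt mz.
- by exists m.
Qed.

(** Since [X] is complete with a minimum, a map [alpha] factors through [beta]
    by an order-preserving map as soon as it is monotone relative to [beta] and
    is bounded above on every set where [beta] is: the factor sends [x] to the
    supremum of the values [alpha p] with [beta p <= x]. *)
Lemma OX_factor (alpha beta : X -> X) :
  (forall p q, beta p <= beta q -> alpha p <= alpha q) ->
  (forall x, exists u, forall p, beta p <= x -> alpha p <= u) ->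
  exists2 psi, OX psi & alpha = psi \o beta.
Proof.
move=> mono bdd; pose S x := [set alpha p | p in [set p | beta p <= x]].
have /choice[psi psiP] x :
    exists s, ubound (S x) s /\ forall v, ubound (S x) v -> s <= v.
  by have [u uP] := bdd x; apply: (@exists_lub _ u) => _ [p /= /uP ? <-].
exists psi.
  move=> x y xy; apply: (psiP x).2 => _ [p /= px <-]; apply: (psiP y).1.
  by exists p => //=; apply: le_trans xy.
apply/funext => q /=; apply/le_anti/andP; split.
  by apply: (psiP _).1; exists q => /=.
by apply: (psiP _).2 => _ [p /= + <-]; apply: mono.
Qed.

(** Adding the minimum of [X] to an open convex set does not prevent it from
    being embedded cofinally into a chain of the same type: the minimum is sent
    to a point of that chain, and the open convex set onto the part above it. *)
Lemma cofinal_embedding D Y : open_convex D -> ~ D a -> iso_open Y ->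
  exists e, [/\ strict_on (a |` D) e, (forall x, (a |` D) x -> Y (e x)) &
                forall y, Y y -> exists2 x, D x & y <= e x].
Proof.
move=> oD nDa [C [oC YC]].
have /order_isomorphicP[m sm mY] : order_isomorphic D Y.
  apply: order_isomorphic_trans (X_open_convex oD oC) _.
  exact: order_isomorphic_sym.
have [[a' Da'] _ _ _] := oD.
have oD' := open_convex_above X_dense oD Da'.
have /order_isomorphicP[k sk kD'] := X_open_convex oD oD'.
have kD x : D x -> D (k x) /\ a' < k x.
  by move=> Dx; have : (k @` D) (k x) by [exists x]; rewrite kD' => -[].
have Dgt x : D x -> x <> a by move=> Dx xa; apply: nDa; rewrite -xa.
pose e x := if x == a then m a' else m (k x).
have ea : e a = m a' by rewrite /e eqxx.
have eD x : D x -> e x = m (k x) by move=> /Dgt/eqP/negbTE; rewrite /e => ->.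
have mYY x : D x -> Y (m x) by move=> Dx; rewrite -mY; exists x.
exists e; split.
- move=> x y [->|Dx] [->|Dy] xy.
  + by rewrite ltxx in xy.
  + by rewrite ea eD//; have [Dky ?] := kD _ Dy; apply: sm.
  + by have := le_a x; rewrite leNgt xy.
  + rewrite !eD//; apply: sm; [exact: (kD _ _).1..|exact: sk].
- move=> x [->|Dx]; rewrite ?ea ?eD//; first exact: mYY.
  by apply: mYY; apply: (kD _ _).1.
- move=> y; rewrite -mY => -[z Dz <-].
  have [w [Dw a'w] zw] : exists2 w, (D w /\ a' < w) & z <= w.
    case: (ltP a' z) => [a'z|za']; first by exists z.
    have [w [Dw /= a'w]] : (D `&` [set y | a' < y]) !=set0 by case: oD'.
    by exists w => //; apply: le_trans za' (ltW a'w).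
  have [x Dx kx] : (k @` D) w by rewrite kD'.
  by exists x => //; rewrite eD// kx; apply: (strict_on_le sm).
Qed.

(** * Sufficiency *)

Lemma OPX_factor (phi : X -> X) (X1 Y1 Y2 : set X) (alpha : X -> X) :
  is_ideal phi X1 ->
  Y1 `<=` X1 -> iso_open Y1 -> strict_on Y1 phi ->
  (forall x, exists2 y, Y1 y & x <= phi y) ->
  Y2 `<=` ~` X1 -> iso_open Y2 -> strict_on Y2 phi ->
  OPX alpha -> ~ OX alpha ->
  exists theta psi, [/\ OX theta, OX psi & alpha = psi \o (phi \o theta)].
Proof.
move=> iX Y1X oY1 s1 cof1 Y2X oY2 s2 [A iA] nO.
have /is_idealP[_ _ _ ltX phi12] := iX.
have /is_idealP[[x0 Ax0] f1 f2 ltA f12] := iA.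
have Aa : A a by apply: ideal_lower iA Ax0 (le_a _).
have [c nAc] : exists c, ~ A c.
  by apply: contrapT => H; apply/nO/(ideal_OX iA) => x;
    apply: contrapT => nAx; apply: H; exists x.
(* Either A is the whole of [a, b), or it has a maximum and alpha is bounded. *)
have [b [nAb AbP]] : exists b, ~ A b /\
    ((forall x, x < b -> A x) \/ exists u, forall x, alpha x <= u).
  have [|p q Ap nAq|||[m [Am ubm]]|[b [nAb lbb]]] :=
      X_cut (X' := A) (X'' := ~` A).
  - exact: setUv.
  - exact: ltA.
  - by exists a.
  - by exists c.
  - exists c; split=> //; right; exists (alpha m) => x.
    case: (pselect (A x)) => Ax; last exact: f12.
    by apply: f1 => //; apply: ubm.
  - exists b; split=> //; left=> x xb; apply: contrapT => nAx.
    by have := lbb _ nAx; rewrite leNgt xb.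
have ab : a < b by apply: ltA.
have [|e1 [se1 e1Y cof_e1]] := cofinal_embedding (open_convex_itv ab) _ oY1.
  by rewrite /= ltxx.
have [|e2 [se2 e2Y _]] := cofinal_embedding (open_convex_ray a) _ oY2.
  by rewrite /= ltxx.
have dom1 x : A x -> (a |` [set x | a < x < b]) x.
  move=> Ax; case: (eqVneq x a) => [->|xa]; [by left|right => /=].
  by rewrite lt_neqAle eq_sym xa le_a ltA.
have dom2 x : (a |` [set x | a < x]) x.
  case: (eqVneq x a) => [->|xa]; [by left|right => /=].
  by rewrite lt_neqAle eq_sym xa le_a.
pose theta x := if pselect (A x) then e1 x else e2 x.
have th1 x : A x -> theta x = e1 x by rewrite /theta; case: pselect.
have th2 x : ~ A x -> theta x = e2 x by rewrite /theta; case: pselect.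
have thY1 x : A x -> Y1 (theta x) by move=> Ax; rewrite th1//; apply/e1Y/dom1.
have thY2 x : ~ A x -> Y2 (theta x).
  by move=> nAx; rewrite th2//; apply/e2Y/dom2.
have s_th : strict_on setT theta.
  move=> x y _ _ xy; case: (pselect (A x)) => Ax; case: (pselect (A y)) => Ay.
  - by rewrite !th1//; apply: se1 => //; apply: dom1.
  - by apply: ltX; [apply/Y1X/thY1|apply/Y2X/thY2].
  - by case: (ideal_compl_up iA Ax (ltW xy)).
  - by rewrite !th2//; apply: se2.
have beta1 p q : A p -> A q -> p < q -> phi (theta p) < phi (theta q).
  by move=> Ap Aq pq; apply: s1; [exact: thY1..|exact: s_th].
have beta2 p q : ~ A p -> ~ A q -> p < q -> phi (theta p) < phi (theta q).
  by move=> Ap Aq pq; apply: s2; [exact: thY2..|exact: s_th].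
(* The values of phi after theta on the complement of A have no maximum, hence
   they are strictly below the values on A. *)
have beta21 p q : A p -> ~ A q -> phi (theta q) < phi (theta p).
  move=> Ap nAq; have [r qr] := exists_gt q.
  have nAr := ideal_compl_up iA nAq (ltW qr).
  apply: lt_le_trans (beta2 _ _ nAq nAr qr) _.
  by apply: phi12; [apply/Y1X/thY1|apply/Y2X/thY2].
have mono p q : phi (theta p) <= phi (theta q) -> alpha p <= alpha q.
  move=> bpq; case: (pselect (A p)) => Ap; case: (pselect (A q)) => Aq.
  - by apply: f1 => //; rewrite leNgt; apply/negP => /(beta1 _ _ Aq Ap);
      rewrite ltNge bpq.
  - by have := beta21 _ _ Ap Aq; rewrite ltNge bpq.
  - exact: f12.
  - by apply: f2 => //; rewrite leNgt; apply/negP => /(beta2 _ _ Aq Ap);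
      rewrite ltNge bpq.
have [psi psiO ->] : exists2 psi, OX psi & alpha = psi \o (phi \o theta).
  apply: OX_factor => [|x]; first exact: mono.
  case: AbP => [Ab|[u uP]]; last by exists u.
  have [y Yy xy] := cof1 x; have [p /= /andP[ap pb] yp] := cof_e1 _ Yy.
  have Ap := Ab _ pb; exists (alpha p) => q bqx; apply: mono => /=.
  apply: le_trans bqx (le_trans xy _).
  by rewrite (strict_on_le s1)//; [exact: thY1|rewrite th1].
exists theta, psi; split=> //.
by move=> x y; apply: strict_on_le s_th _ _.
Qed.

(** * Necessity *)

(** Such a map sends the minimum [a] to some [c], and all other points into the
    interval from [a] to [c]. *)
Lemma exists_injective_OPX :
  exists f : X -> X, [/\ OPX f, injective f & ~ OX f].
Proof.
have [c ac] := exists_gt a.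
have /order_isomorphicP[k sk kE] :=
  X_open_convex (open_convex_ray a) (open_convex_itv ac).
have kP x : a < x -> a < k x < c.
  by move=> ax; have : (k @` [set x | a < x]) (k x) by [exists x]; rewrite kE.
pose f x := if x == a then c else k x.
have fa : f a = c by rewrite /f eqxx.
have fE x : x <> a -> f x = k x by move=> /eqP/negbTE; rewrite /f => ->.
have gt x : x <> a -> a < x by move=> /eqP xa; rewrite lt_neqAle eq_sym xa le_a.
have fc x : x <> a -> f x < c.
  by move=> xa; rewrite fE//; case/andP: (kP _ (gt _ xa)).
exists f; split.
- exists [set a]; apply/is_idealP; split=> /=; first by exists a.
  + by move=> x y -> ->.
  + move=> x y xa ya xy; rewrite !fE//.
    by apply: (strict_on_le sk) => //; apply: gt.
  + by move=> x y -> ya; apply: gt.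
  + by move=> x y -> ya; rewrite fa; apply/ltW/fc.
- move=> x y; case: (pselect (x = a)) => [->|xa];
    case: (pselect (y = a)) => [->|ya] //.
  + by rewrite fa => e; have := fc _ ya; rewrite -e ltxx.
  + by rewrite fa => e; have := fc _ xa; rewrite e ltxx.
  + by rewrite !fE//; apply: (strict_on_inj sk) => //; apply: gt.
- move=> /(_ a c (le_a c)); rewrite fa leNgt fc// => ca.
  by rewrite ca ltxx in ac.
Qed.

(** Otherwise all injective elements of the generated semigroup would be
    order-preserving.  In the proof this is strengthened, to be stable under
    composition: if [f] applied after an order-preserving [h] is injective,
    then it is order-preserving. *)
Lemma generated_embeds_compl (phi : X -> X) (X1 : set X) :
  is_ideal phi X1 ->
  generated_subsemigroup (OX `|` [set phi]) = OPX ->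
  exists Y, [/\ Y `<=` ~` X1, iso_open Y & strict_on Y phi].
Proof.
move=> iX gen; have /is_idealP[_ phi1 phi2 _ _] := iX.
apply: contrapT => noY.
pose S f := forall h, OX h -> injective (f \o h) -> OX (f \o h).
have [f [fOP finj nO]] := exists_injective_OPX; apply: nO.
suff Sf : S f by apply: (Sf id).
rewrite -gen in fOP; apply: fOP; split=> [g1 g2 S1 S2 h hO inj|g [gO|->]].
- apply: (S2 (g1 \o h)) => //; apply: S1 => // x y /= e.
  by apply: inj => /=; rewrite e.
- by move=> h hO _; apply: OX_comp.
- move=> h hO inj.
  case: (pselect (exists q, ~ X1 (h q))) => [[q nq]|nq]; last first.
    have hX x : X1 (h x) by apply: contrapT => nx; apply: nq; exists x.
    by move=> x y xy; apply: phi1 => //; apply: hO.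
  case: noY; pose Q := [set x | q < x].
  have hQ x : Q x -> ~ X1 (h x).
    by move=> qx; apply: ideal_compl_up iX nq (hO _ _ (ltW qx)).
  have sh : strict_on Q h.
    apply: strict_on_homo_inj => x y Qx Qy; first exact: hO.
    by move=> e; apply: inj => /=; rewrite e.
  exists (h @` Q); split.
  + by move=> _ [x Qx <-]; apply: hQ.
  + apply: iso_open_image sh; apply: open_convex_iso_open.
    exact: open_convex_ray.
  + move=> _ _ [x Qx <-] [y Qy <-] hxy.
    rewrite lt_neqAle phi2 ?(ltW hxy) ?andbT//; [|exact: hQ..].
    by apply/eqP => /inj exy; rewrite exy ltxx in hxy.
Qed.

(** [f] is unbounded on every final segment of [Y]. *)
Definition unbounded_along Y f :=
  forall y x, Y y -> exists z, [/\ Y z, y <= z & x < f z].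

(** Such a map stretches the interval from [a] to [b] onto all points above [a],
    and sends all other points to [a]. *)
Lemma exists_unbounded_OPX : exists (f : X -> X) Y u,
  [/\ OPX f, iso_open Y, ubound Y u, strict_on Y f & unbounded_along Y f].
Proof.
have [b ab] := exists_gt a.
have oI := open_convex_itv ab.
have /order_isomorphicP[k sk kE] := X_open_convex oI (open_convex_ray a).
pose f x := if a < x < b then k x else a.
have fE x : a < x < b -> f x = k x by rewrite /f => ->.
have fN x : ~~ (a < x < b) -> f x = a by rewrite /f => /negbTE ->.
exists f, [set x | a < x < b], b; split.
- exists [set x | x < b]; apply/is_idealP; split=> /=.
  + by exists a.
  + move=> x y xb yb xy.
    case: (boolP (a < x < b)) => [Ix|/fN->]; last exact: le_a.
    have Iy : a < y < b.
      by rewrite yb andbT; case/andP: Ix => ax _; apply: lt_le_trans xy.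
    by rewrite !fE//; apply: strict_on_le sk _ _ _.
  + by move=> x y /negP/negbTE nx _ _; rewrite fN ?le_a// nx andbF.
  + by move=> x y xb /negP; rewrite -leNgt; apply: lt_le_trans.
  + by move=> x y _ /negP/negbTE ny; rewrite fN ?le_a// ny andbF.
- exact: open_convex_iso_open.
- by move=> x /= /andP[_ /ltW].
- by move=> x y Ix Iy xy; rewrite !fE//; apply: sk.
- move=> y x Iy; have ak : a < k y.
    by have : (k @` [set x | a < x < b]) (k y) by [exists y]; rewrite kE.
  have [w xw] := exists_gt (Order.max x (k y)).
  move: xw; rewrite gt_max => /andP[xw kw].
  have [z Iz zw] : (k @` [set x | a < x < b]) w.
    by rewrite kE /=; apply: lt_trans kw.
  exists z; split=> //; last by rewrite fE// zw.
  by apply/ltW/(strict_on_lt_inv sk) => //; rewrite zw.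
Qed.

(** An orientation-preserving map is order-preserving on the part of [Y] above
    some point of [Y]. *)
Lemma OPX_final_homo f Y : OPX f -> Y !=set0 ->
  (exists2 y, Y y & forall z w, Y z -> Y w -> y < z -> z <= w -> f z <= f w).
Proof.
move=> [A iA] [y0 Yy0]; have /is_idealP[_ f1 f2 _ _] := iA.
case: (pselect (exists y, Y y /\ ~ A y)) => [[y [Yy nAy]]|H].
  exists y => // z w Yz Yw yz zw; apply: f2 => //.
    exact: ideal_compl_up iA nAy (ltW yz).
  exact: ideal_compl_up iA nAy (le_trans (ltW yz) zw).
have YA y : Y y -> A y by move=> Yy; apply: contrapT => nA; apply: H; exists y.
by exists y0 => // z w Yz Yw _; apply: f1; apply: YA.
Qed.

(** Otherwise no element of the generated semigroup could be both injective on
    a bounded set of open convex type and unbounded along it: some single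
    factor would have to stretch a bounded set to an unbounded one, but
    order-preserving maps send bounded sets to bounded sets, and [phi] is
    unbounded along a set only if that set lies in its ideal. *)
Lemma generated_embeds_ideal (phi : X -> X) (X1 : set X) :
  is_ideal phi X1 ->
  generated_subsemigroup (OX `|` [set phi]) = OPX ->
  exists Y, [/\ Y `<=` X1, iso_open Y, strict_on Y phi &
                forall x, exists2 y, Y y & x <= phi y].
Proof.
move=> iX gen; have /is_idealP[[x1 Xx1] phi1 _ _ phi12] := iX.
apply: contrapT => noY.
pose S f := OPX f /\ forall Y u, iso_open Y -> ubound Y u ->
  (forall x y, Y x -> Y y -> f x = f y -> x = y) -> ~ unbounded_along Y f.
have [f [Y [u [fOP oY uY sf uf]]]] := exists_unbounded_OPX.
suff [_ Sf] : S f.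
  by apply: (Sf _ _ oY uY) uf => x y Yx Yy; apply: strict_on_inj sf Yx Yy.
rewrite -gen in fOP; apply: fOP.
split=> [g1 g2 [OP1 S1] [OP2 S2]|g [gO|->]].
- split; first exact: OPX_comp.
  move=> {Y u oY uY sf uf}Y u oY uY inj unb.
  have [y0 Yy0] : Y !=set0 by apply: iso_open_neq0.
  have [y Yy hom] := OPX_final_homo OP1 (ex_intro _ y0 Yy0).
  (* On the final segment Z of Y, g1 is an embedding.  If its image is
     unbounded, then g1 is unbounded along Z; if not, g2 is unbounded along
     that image. *)
  pose Z := Y `&` [set z | y < z].
  have oZ : iso_open Z by apply: iso_open_above.
  have sZ : strict_on Z g1.
    apply: strict_on_homo_inj; first by move=> z w [Yz yz] [Yw _]; apply: hom.
    by move=> z w [Yz _] [Yw _] e; apply: inj => //=; rewrite e.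
  have [v uv] : exists v, ubound (g1 @` Z) v.
    apply: contrapT => nub; apply: (S1 Z u oZ).
    + by move=> z [Yz _]; apply: uY.
    + by move=> z w Zz Zw; apply: strict_on_inj sZ Zz Zw.
    + move=> z x Zz; apply: contrapT => nz.
      apply: nub; exists (Order.max x (g1 z)) => _ [w Zw <-]; rewrite le_max.
      case: (leP z w) => [zw|/ltW wz]; last by rewrite (strict_on_le sZ) ?orbT.
      rewrite leNgt; case: (ltP x (g1 w)) => // xw.
      by case: nz; exists w.
  apply: (S2 (g1 @` Z) v) => //; first exact: iso_open_image.
    by move=> _ _ [z [Yz _] <-] [w [Yw _] <-] e; congr g1; apply: inj.
  move=> _ x [z [Yz /= yz] <-]; have [w [Yw zw xw]] := unb z x Yz.
  have Zw : Z w by split=> //=; apply: lt_le_trans zw.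
  by exists (g1 w); split=> //; [exists w|apply: hom].
- split; first exact: OX_OPX a _ gO.
  move=> {Y u oY uY sf uf}Y u oY uY _ unb.
  have [y0 Yy0] : Y !=set0 by apply: iso_open_neq0.
  have [z [Yz _]] := unb y0 (g u) Yy0.
  by rewrite ltNge gO//; apply: uY.
- split; first by exists X1.
  move=> {Y u oY uY sf uf}Y u oY uY inj unb; apply: noY.
  have YX : Y `<=` X1.
    move=> y Yy; apply: contrapT => nXy.
    have [z [Yz yz]] := unb y (phi x1) Yy.
    by rewrite ltNge phi12//; apply: ideal_compl_up iX nXy yz.
  have [y0 Yy0] : Y !=set0 by apply: iso_open_neq0.
  exists Y; split=> //.
  + by apply: strict_on_homo_inj inj => x y /YX Xx /YX; apply: phi1.
  + by move=> x; have [z [Yz _ /ltW xz]] := unb y0 x Yy0; exists z.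
Qed.

End MinimumNoMaximum.

Theorem proposition7 (d : Order.disp_t) (X : orderType d)
  (X_infinite : infinite_set [set: X])
  (X_dense : dense_chain X)
  (X_cut : cut_condition X)
  (X_open_convex : open_convex_isomorphic X)
  (a : X) (a_min : is_min [set: X] a)
  (X_no_max : ~ has_max [set: X])
  (phi : X -> X) (phi_OP : OPX phi) (phi_not_O : ~ OX phi)
  (X1 X2 : set X) (X1_ideal : is_ideal phi X1) (X2_def : X2 = ~` X1) :
  generated_subsemigroup (OX `|` [set phi]) = OPX <->
  exists Y1 Y2 : set X,
    [/\ [/\ Y1 `<=` X1,
            (exists C, open_convex C /\ order_isomorphic Y1 C) &
            order_iso Y1 (phi @` Y1) phi],
        [/\ Y2 `<=` X2,
            (exists C, open_convex C /\ order_isomorphic Y2 C) &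
            order_iso Y2 (phi @` Y2) phi] &
        [set x | forall y, Y1 y -> phi y < x] = set0].
Proof.
rewrite X2_def; split=> [gen|[Y1 [Y2]]].
  have [Y1 [YX1 oY1 s1 cof1]] := generated_embeds_ideal X_dense X_open_convex
    a_min X_no_max X1_ideal gen.
  have [Y2 [YX2 oY2 s2]] := generated_embeds_compl X_dense X_open_convex
    a_min X_no_max X1_ideal gen.
  exists Y1, Y2; split; [by split=> //; apply/order_isoE..|].
  rewrite -subset0 => x /= xP; have [y Yy] := cof1 x.
  by rewrite leNgt xP.
move=> [[YX1 oY1 /order_isoE[s1 _]] [YX2 oY2 /order_isoE[s2 _]] cof].
have cof1 x : exists2 y, Y1 y & x <= phi y.
  apply: contrapT => nx.
  suff : set0 x by [].
  rewrite -cof /= => y Yy; rewrite ltNge; apply/negP => xy.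
  by apply: nx; exists y.
rewrite eqEsubset; split=> [f|alpha aOP].
  apply; split=> [g h|g [|->//]]; first exact: OPX_comp.
  exact: OX_OPX.
move=> G [Gcomp Ggen].
have GO g : OX g -> G g by move=> gO; apply: Ggen; left.
have Gphi : G phi by apply: Ggen; right.
case: (pselect (OX alpha)) => [/GO//|nO].
have [theta [psi [thO psO ->]]] := OPX_factor X_dense X_cut X_open_convex
  a_min X_no_max X1_ideal YX1 oY1 s1 cof1 YX2 oY2 s2 aOP nO.
exact: Gcomp (Gcomp _ _ (GO _ thO) Gphi) (GO _ psO).
Qed.
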